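(* $$\sum_{\pi\in\mathcal{E}_O^{N}}q^{|\pi|}=\sum_{m\geq1}\frac{1}{(q;q)_m} \left[q^m+\sum_{k=1}^{m-1}q^{km-\binom{k}{2}}\right].$$
   Context: An overpartition is a finite non-increasing sequence of positive integers (its parts) in which the first occurrence of each number may be overlined (so for each size $t$ at most one part of size $t$ is overlined); the size of a part $t$ or $\overline{t}$ is $t$, and the weight $|\pi|$ is the sum of the sizes of the parts. $\mathcal{E}_O^{N}$ is the set of overpartitions in which at least one non-overlined part appears and the sizes of all non-overlined parts are greater than or equal to the sizes of all overlined parts (if any). Here $|q|<1$ (or $q$ is a formal variable), $(q;q)_m=\prod_{i=1}^{m}(1-q^i)$. *)

(* Defs.v *)
From HB Require Import structures.
From mathcomp Require Import all_boot all_order all_algebra.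
From mathcomp Require Import complex.
From mathcomp Require Import all_classical all_reals all_analysis.
From mathcomp Require Import showcase.summability.

Set Implicit Arguments.
Unset Strict Implicit.
Unset Printing Implicit Defensive.

Import Order.TTheory GRing.Theory Num.Theory.
Import numFieldNormedType.Exports.

(* A part is a pair (size, overlined?). *)
Definition part : Type := (nat * bool)%type.

Definition psize (p : part) : nat := p.1.
Definition overlined (p : part) : bool := p.2.

(* The last clause says that an overlined part is not preceded by a part of
   the same size, i.e. only the first occurrence of a size can be overlined. *)
Definition is_overpartition (s : seq part) : bool :=
  [&& all (fun p => 0 < psize p)%N s,
      sorted geq (map psize s)
    & pairwise (fun p p' => overlined p' ==> (psize p != psize p')) s].

Record overpartition : Type := Overpartition {
  parts :> seq part;
  _ : is_overpartition parts }.

HB.instance Definition _ := [isSub for parts].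
HB.instance Definition _ := [Choice of overpartition by <:].

Definition weight (o : overpartition) : nat := sumn (map psize (parts o)).

Definition in_EON (o : overpartition) : bool :=
  has (fun p => ~~ overlined p) (parts o) &&
  allrel (fun p p' => (psize p' <= psize p)%N)
    [seq p <- parts o | ~~ overlined p] [seq p <- parts o | overlined p].

Definition EON : Type := {o : overpartition | in_EON o}.
HB.instance Definition _ := Choice.on EON.

Local Open Scope ring_scope.

Definition qpoch (K : comNzRingType) (q : K) (m : nat) : K :=
  \prod_(1 <= i < m.+1) (1 - q ^+ i).

(* The subtraction in the exponent is never truncated: 'C(k, 2) <= k * m
   whenever k <= m. *)
Definition rhs_term (K : fieldType) (q : K) (m : nat) : K :=
  (qpoch q m)^-1 *
  (q ^+ m + \sum_(1 <= k < m) q ^+ (k * m - 'C(k, 2))).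

(* Main.v *)
(** Let [m] be the number of parts of an element of E_O^N, [k] of them
    overlined. Listed increasingly, the overlined sizes come first; they are
    distinct, hence at least 1, 2, ..., k, and the other sizes are at least
    max(1, k). Subtracting this staircase leaves an arbitrary nondecreasing
    sequence of length [m], that is, a partition into at most [m] parts. The
    staircase has weight [m] if [k = 0] and [k m - 'C(k, 2)] otherwise, so the
    elements with given [m] and [k] contribute the [k]-th summand of the [m]-th
    term. Grouping an unconditionally convergent family along the fibres of an
    integer-valued statistic is legitimate once the sums of the norms over
    finite unions of fibres are bounded; this is applied to the smallest
    element (for the generating function of partitions), to [k], and to [m]. *)

Require Import Defs.
From HB Require Import structures.
From mathcomp Require Import all_boot all_order all_algebra.
From mathcomp Require Import complex.
From mathcomp Require Import all_classical all_reals all_analysis.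
From mathcomp Require Import showcase.summability.
From mathcomp Require Import finmap zify ring.

Import Order.TTheory GRing.Theory Num.Theory.
Import numFieldNormedType.Exports.

Local Open Scope classical_set_scope.
Local Open Scope ring_scope.

#[local] Existing Instance totally_filter.

(** * Unconditional sums *)

Section FsetSums.

Variables (R : realType) (I : choiceType).
Implicit Types (D : pred I) (A B : {fset I}).

(** The predicate restricts the summands, not the index type, so that the sums over all fibres run
    along one filter of finite sets. *)
Definition psum {V : nmodType} D (f : I -> V) A : V := \sum_(i <- A | D i) f i.

Lemma totally_ge A : \forall B \near totally, (A `<=` B)%fset.
Proof. by exists A. Qed.

Lemma psum_fsetI {V : nmodType} (D E : pred I) (f : I -> V) A :
  psum D f [fset i in A | E i]%fset = psum (fun i => E i && D i) f A.
Proof.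
by rewrite /psum big_mkcond big_fset /= [RHS]big_mkcondr.
Qed.

Lemma le_psum D (g : I -> R) A B : (forall i, 0 <= g i) -> (A `<=` B)%fset ->
  psum D g A <= psum D g B.
Proof.
move=> g0 AB; rewrite /psum ![\sum_(_ <- _ | D _) _]big_mkcond/=.
rewrite [leRHS](big_fsetID _ (mem A)) /=.
have -> : [fset x in B | mem A x]%fset = A.
  apply/fsetP => i; rewrite !inE /= andbC.
  by case: (boolP (i \in A)) => // /(fsubsetP AB).
rewrite lerDl sumr_ge0// => i _.
by case: ifP.
Qed.

(** A bounded increasing net of reals converges to its supremum. *)
Lemma cvg_psum_ge0 D (g : I -> R) (M : R) : (forall i, 0 <= g i) ->
  (forall A, psum D g A <= M) -> cvg (psum D g @ totally).
Proof.
move=> g0 gM; have hs : has_sup (range (psum D g)).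
  by split; [exists (psum D g fset0), fset0 | exists M => _ [A _ <-]].
apply/cvg_ex; exists (sup (range (psum D g))); apply/cvgrPdist_lt => e e0.
have [_ [A _ <-] lt_A] := sup_adherent e0 hs.
exists A => // B /= AB; rewrite ger0_norm ?subr_ge0; last first.
  by apply: ub_le_sup; [exact: hs.2 | exists B].
by rewrite ltrBlDl -ltrBlDr (lt_le_trans lt_A)// le_psum.
Qed.

Lemma cvg_psum_abs D (f : I -> R) (M : R) :
  (forall A, psum D (fun i => `|f i|) A <= M) -> cvg (psum D f @ totally).
Proof.
move=> fM.
(* A difference of two families of nonnegative terms, with finite sums bounded by [M + M] and
   [M]. *)
have -> : psum D f =
    psum D (fun i => f i + `|f i|) \- psum D (fun i => `|f i|).
  by apply/funext => A; rewrite /psum /= -sumrB; apply: eq_bigr => i _; rewrite addrK.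
apply: is_cvgB; last exact: cvg_psum_ge0 fM.
apply: (@cvg_psum_ge0 _ _ (M + M)) => [i|A].
  by rewrite addrC -[f i]opprK subr_ge0 normrN ler_norm.
rewrite /psum big_split/= lerD// (le_trans _ (fM A))// ler_sum// => i _.
exact: ler_norm.
Qed.

Local Notation C := (R[i]^o).

Lemma ler_normc_ReIm (z : R[i]) : `|z| <= (`|complex.Re z| + `|complex.Im z|)%:C%C.
Proof.
have -> : `|z| = `|(complex.Re z)%:C + 'i * (complex.Im z)%:C|%C by rewrite -complexE.
apply: (le_trans (ler_normD _ _)); rewrite normrM.
rewrite !normc_def /= !expr0n /= !addr0 add0r expr1n sqrtr1 mul1r.
by rewrite !sqrtr_sqr rmorphD.
Qed.

Lemma ger_normc_Im (z : R[i]) : `|complex.Im z|%:C%C <= `|z|.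
Proof.
rewrite normc_def lecR -sqrtr_sqr ler_wsqrtr// lerDr.
exact: sqr_ge0.
Qed.

(* The completeness of the complex numbers enters only here, through the real
   and imaginary parts. *)
Lemma cvg_psum_absc D (f : I -> C) (M : R[i]) :
  (forall A, psum D (fun i => `|f i|) A <= M) -> cvg (psum D f @ totally).
Proof.
move=> fM.
have Re_psum A : complex.Re (psum D f A : R[i]) =
    psum D (fun i => complex.Re (f i : R[i])) A.
  by apply: (big_morph (@complex.Re R)) => // -[? ?] [? ?].
have Im_psum A : complex.Im (psum D f A : R[i]) =
    psum D (fun i => complex.Im (f i : R[i])) A.
  by apply: (big_morph (@complex.Im R)) => // -[? ?] [? ?].
have norm_psum A : (psum D (fun i => complex.Re `|f i|) A)%:C%C <= M.
  apply: le_trans (fM A); rewrite /psum rmorph_sum; apply: ler_sum => i _.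
  by rewrite le_eqVlt; apply/orP; left; apply/eqP/RRe_real/normr_real.
(* In [R[i]], [<=] means equal imaginary parts and ordered real parts, so the bound passes to
   [complex.Re M]. *)
have norm_psumR A : psum D (fun i => complex.Re `|f i|) A <= complex.Re M.
  by have := norm_psum A; rewrite lecE /= => /andP[].
have [a fa] : exists a : R, psum D (fun i => complex.Re (f i : R[i])) @ totally --> a.
  apply/cvg_ex/(@cvg_psum_abs _ _ (complex.Re M)) => A.
  apply: le_trans (norm_psumR A); apply: ler_sum => i _.
  by have := normc_ge_Re (f i); rewrite lecE /= => /andP[].
have [b fb] : exists b : R, psum D (fun i => complex.Im (f i : R[i])) @ totally --> b.
  apply/cvg_ex/(@cvg_psum_abs _ _ (complex.Re M)) => A.
  apply: le_trans (norm_psumR A); apply: ler_sum => i _.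
  by have := ger_normc_Im (f i); rewrite lecE /= => /andP[].
apply/cvg_ex; exists (Complex a b : C); apply/cvgrPdist_lt => -[e e'].
rewrite ltcE /= => /andP[/eqP -> e0].
have e20 : 0 < e / 2 by rewrite divr_gt0.
move/cvgrPdist_lt: fa => /(_ _ e20) fa; move/cvgrPdist_lt: fb => /(_ _ e20) fb.
near=> A; apply: le_lt_trans (ler_normc_ReIm _) _.
rewrite ltcR raddfB raddfB /= Re_psum Im_psum [ltRHS]splitr ltrD//; near: A.
Unshelve. all: by end_near. Qed.

End FsetSums.

Arguments psum {I V}.
Arguments totally_ge {I}.

(** Stands in for completeness, so that the argument can be run over an abstract [numFieldType]. *)
Definition abs_summable_cvg (K : numFieldType) : Prop :=
  forall (I : choiceType) (D : pred I) (f : I -> K) (M : K),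
  (forall A, psum D (fun i => `|f i|) A <= M) -> cvg (psum D f @ totally).

Lemma complex_abs_summable_cvg (R : realType) : abs_summable_cvg R[i].
Proof. by move=> I D f M; exact: cvg_psum_absc. Qed.

(** * Sums with bounded norms, and grouping along fibres *)

Section AbsSum.

Variables (K : numFieldType) (I : choiceType).
Implicit Types (D : pred I) (A B : {fset I}).

(** The sum travels with a bound [M] on all finite sums of norms, because grouping infinitely many
    fibres needs control of these bounds. *)
Definition abs_sum D (f : I -> K) (s M : K) : Prop :=
  psum D f @ totally --> s /\ forall A, psum D (fun i => `|f i|) A <= M.

Lemma eq_abs_sum D E (f g : I -> K) s M : D =1 E -> (forall i, D i -> f i = g i) ->
  abs_sum D f s M -> abs_sum E g s M.
Proof.
move=> DE fg; rewrite /abs_sum.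
have eq_psum (V : nmodType) (h k : I -> V) :
    (forall i, D i -> h i = k i) -> psum D h = psum E k.
  by move=> hk; apply/funext => A; rewrite /psum -(eq_bigl _ _ DE); exact: eq_bigr.
by rewrite (eq_psum _ _ _ fg) (eq_psum _ _ (fun i => `|g i|))// => i /fg ->.
Qed.

Lemma abs_sum0 (f : I -> K) : abs_sum pred0 f 0 0.
Proof.
split=> [|A]; last by rewrite /psum big_pred0.
rewrite [psum _ _](_ : _ = cst 0); first exact: cvg_cst.
by apply/funext => A; rewrite /psum big_pred0.
Qed.

Lemma abs_sum1 (i : I) (f : I -> K) : abs_sum (pred1 i) f (f i) `|f i|.
Proof.
have psum1 (V : nmodType) (g : I -> V) A :
    psum (pred1 i) g A = if i \in A then g i else 0.
  rewrite /psum; case: ifPn => iA.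
    rewrite big_mkcond (big_fsetD1 i)//= eqxx big_seq big1 ?addr0// => j.
    by rewrite !inE => /andP[/negbTE ->].
  by rewrite big_seq_cond big1// => j /andP[jA /eqP ij]; rewrite -ij jA in iA.
split=> [|A]; last by rewrite psum1; case: ifP.
apply/cvgrPdist_lt => e e0; exists [fset i]%fset => // A /= /fsubsetP iA.
by rewrite psum1 iA ?inE// subrr normr0.
Qed.

Lemma abs_sumZ D c (f : I -> K) s M :
  abs_sum D f s M -> abs_sum D (fun i => c * f i) (c * s) (`|c| * M).
Proof.
move=> [fs fM]; split=> [|A].
  rewrite [psum _ _](_ : _ = (fun A => c * psum D f A)).
    by apply: cvgM; [exact: cvg_cst|].
  by apply/funext => A; rewrite /psum mulr_sumr.
rewrite /psum; under eq_bigr do rewrite normrM.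
rewrite -mulr_sumr ler_wpM2l//; exact: fM.
Qed.

Lemma abs_sum_partition D (f : I -> K) (st : I -> nat) s M N :
  (forall n, (n < N)%N -> abs_sum (fun i => D i && (st i == n)) f (s n) (M n)) ->
  abs_sum (fun i => D i && (st i < N)%N) f
    (\sum_(0 <= n < N) s n) (\sum_(0 <= n < N) M n).
Proof.
elim: N => [_|N IH sM].
  rewrite !big_nil; apply: eq_abs_sum (abs_sum0 f) => // i.
  by rewrite ltn0 andbF.
have psumS (V : nmodType) (g : I -> V) A : psum (fun i => D i && (st i < N.+1)%N) g A =
    psum (fun i => D i && (st i < N)%N) g A + psum (fun i => D i && (st i == N)) g A.
  rewrite /psum (bigID (fun i => st i == N)) /= addrC.
  by congr (_ + _); apply: eq_bigl => i; rewrite ltnS leq_eqVlt; lia.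
have [fs fM] := IH (fun n nN => sM n (ltnW nN)).
have [gs gM] := sM N (ltnSn N).
rewrite !big_nat_recr//=; split=> [|A]; last by rewrite psumS lerD.
by rewrite [psum _ _](funext (psumS _ f)); exact: cvgD.
Qed.

(** A finite set meets finitely many fibres, so [M'] bounds all finite sums of norms and a sum [S]
    exists. For large [N], a single finite set has its sum close both to [S] and to the sum of the
    first [N] fibres. *)
Lemma abs_sum_fibers (cvgK : abs_summable_cvg K) D (f : I -> K) (st : I -> nat) s M M' :
  (forall n, abs_sum (fun i => D i && (st i == n)) f (s n) (M n)) ->
  (forall N, \sum_(0 <= n < N) M n <= M') ->
  exists2 S, abs_sum D f S M' & (\sum_(0 <= n < N) s n) @[N --> \oo] --> S.
Proof.
move=> sM MM'.
have st_bounded A : exists N, forall i, i \in A -> (st i < N)%N.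
  exists (\sum_(i <- A) st i)%N.+1 => i iA.
  by rewrite ltnS (big_fsetD1 i)//= leq_addr.
have fM' A : psum D (fun i => `|f i|) A <= M'.
  have [N stN] := st_bounded A.
  have [_ /(_ A)] := abs_sum_partition D f st s M N (fun n _ => sM n).
  move=> /le_trans -/(_ _ (MM' N)); congr (_ <= _).
  rewrite /psum big_seq_cond [RHS]big_seq_cond; apply: eq_bigl => i.
  by case: (boolP (i \in A)) => //= /stN ->; rewrite andbT.
have /cvg_ex[S fS] := cvgK I D f M' fM'.
exists S => //; apply/cvgrPdist_lt => e e0.
have e20 : 0 < e / 2 by rewrite divr_gt0.
move/cvgrPdist_lt: fS => /(_ _ e20)[A _ /= fS].
have [N0 stN] := st_bounded A.
exists N0 => // N /= N0N.
have [/cvgrPdist_lt/(_ _ e20) fN _] := abs_sum_partition D f st s M N (fun n _ => sM n).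
have [B [AB fB]] := filter_ex (filterI (totally_ge A) fN).
(* Discarding the fibres from [N] on keeps all of [A], as [N0 <= N]. Hence the sum over [B'] is near
   [S], and it equals the restricted sum over [B], which is near the sum of the fibres. *)
pose B' := [fset i in B | (st i < N)%N]%fset.
rewrite [ltRHS]splitr; apply: le_lt_trans (ler_distD (psum D f B') _ _) _.
rewrite ltrD//; last first.
  rewrite distrC psum_fsetI; move: fB; congr (`|_ - _| < _).
  by apply: eq_bigl => i; rewrite andbC.
apply: fS; apply/fsubsetP => i iA; rewrite !inE /= (fsubsetP AB)//=.
exact: leq_trans (stN _ iA) N0N.
Qed.

End AbsSum.

(** * The generating function of partitions *)

(** A separate hypothesis, since it can fail in a non-Archimedean field. *)
Definition power_cvg0 (K : numFieldType) : Prop :=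
  forall x : K, `|x| < 1 -> x ^+ n @[n --> \oo] --> (0 : K).

Lemma complex_power_cvg0 (R : realType) : power_cvg0 R[i].
Proof.
move=> x x1; have [r r_x] : exists r : R, `|x| = r%:C%C.
  by exists (complex.Re `|x|); rewrite RRe_real ?normr_real.
have r0 : 0 <= r by rewrite -ler0c -r_x.
have r1 : r < 1 by rewrite -ltcR -r_x.
apply/cvgrPdist_lt => -[e e']; rewrite ltcE /= => /andP[/eqP -> e0].
have /cvgrPdist_lt/(_ _ e0)[N _ rN] : r ^+ n @[n --> \oo] --> (0 : R).
  by apply: cvg_expr; rewrite ger0_norm.
exists N => // n /rN /=.
rewrite !sub0r !normrN => rn; suff: `|x ^+ n| < e%:C%C by [].
by rewrite normrX r_x -rmorphXn ltcR; exact: le_lt_trans (ler_norm _) rn.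
Qed.

Lemma geometric_sum (K : fieldType) (x : K) N : x != 1 ->
  \sum_(0 <= n < N) x ^+ n = (1 - x ^+ N) / (1 - x).
Proof.
move=> x1; rewrite big_mkord -opprB subrX1 -mulNr opprB mulrC mulKf//.
by rewrite subr_eq0 eq_sym.
Qed.

Lemma qpochS (K : comNzRingType) (q : K) m :
  qpoch q m.+1 = qpoch q m * (1 - q ^+ m.+1).
Proof. by rewrite /qpoch big_nat_recr. Qed.

Lemma cvg_geometric_sum (K : numFieldType) (x : K) :
  power_cvg0 K -> `|x| < 1 ->
  (\sum_(0 <= n < N) x ^+ n) @[N --> \oo] --> (1 - x)^-1.
Proof.
move=> cvg0 x1; have xN1 : x != 1 by apply: contraTneq x1 => ->; rewrite normr1 ltxx.
have : ((1 - x ^+ N) / (1 - x)) @[N --> \oo] --> (1 - 0) / (1 - x).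
  by apply: cvgM; [apply: cvgB; [|exact: cvg0]|]; exact: cvg_cst.
rewrite subr0 mul1r => cvg_quo.
by under eq_cvg do rewrite geometric_sum//.
Qed.

Lemma geometric_sum_le (K : numFieldType) (x : K) N : 0 <= x < 1 ->
  \sum_(0 <= n < N) x ^+ n <= (1 - x)^-1.
Proof.
move=> /andP[x0 x1]; rewrite geometric_sum ?lt_eqF// ler_pdivrMr ?subr_gt0//.
by rewrite mulVf ?gt_eqF ?subr_gt0// lerBlDl lerDr exprn_ge0.
Qed.

(* A nondecreasing sequence of size [m] is a partition into at most [m] parts,
   padded with zeros. *)
Definition encodes_sorted (I : eqType) (m : nat) (D : pred I)
    (cod : I -> seq nat) : Prop :=
  [/\ forall i, D i -> size (cod i) = m /\ sorted leq (cod i),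
      {in D &, injective cod}
    & forall s, size s = m -> sorted leq s -> exists2 i, D i & cod i = s].

(** With the smallest entry [n] fixed, dropping it and subtracting [n] from the rest is a bijection
    onto nondecreasing sequences of length [m]; the inverse adds [n] and puts [n] in front. *)
Lemma encodes_sorted_head (I : eqType) m (D : pred I) cod n :
  encodes_sorted I m.+1 D cod ->
  encodes_sorted I m (fun i => D i && (head 0 (cod i) == n)%N)
    (fun i => map (subn^~ n) (behead (cod i))).
Proof.
move=> [cod_sorted cod_inj cod_surj]; split=> [i /andP[/cod_sorted[]]|i j|s sm s_sorted].
- case: (cod i) => //= n' s [sm] s_sorted /eqP n'n; split; first by rewrite size_map.
  rewrite sorted_map; apply: sub_sorted (path_sorted s_sorted) => x y /=.
  exact: leq_sub2r.
- rewrite !unfold_in => /andP[Di ni] /andP[Dj nj] ij; apply: cod_inj => //.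
  have [_] := cod_sorted _ Di; have [_] := cod_sorted _ Dj; move: ni nj ij.
  have [+ _] := cod_sorted _ Di; have [+ _] := cod_sorted _ Dj.
  case: (cod i) (cod j) => [|x s] [|y t] //= _ _ /eqP -> /eqP -> st.
  rewrite !(path_sortedE leq_trans) => /andP[/allP nt _] /andP[/allP ns _].
  have mapK u : {in u, forall x, (n <= x)%N} -> map (addn^~ n) (map (subn^~ n) u) = u.
    by move=> nu; rewrite -map_comp map_id_in// => z /nu /subnK.
  by rewrite -[s]mapK// st mapK.
- have [||i Di cod_i] := cod_surj (n :: map (addn^~ n) s).
  + by rewrite /= size_map sm.
  + rewrite /= (path_sortedE leq_trans) sorted_map; apply/andP; split.
      by apply/allP => _ /mapP[x _ ->]; exact: leq_addl.
    by apply: sub_sorted s_sorted => x y; rewrite /= leq_add2r.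
  + exists i; first by rewrite Di cod_i /=.
    by rewrite cod_i /= -map_comp map_id_in// => x _; exact: addnK.
Qed.

Lemma sumn_map_subn n s : all (leq n) s ->
  (sumn s = n * size s + sumn (map (subn^~ n) s))%N.
Proof.
elim: s => [|x s IH] /=; first by rewrite muln0.
by move=> /andP[nx /IH ->]; lia.
Qed.

(** Induction on [m], grouping by the smallest entry [n]: it accounts for [n * m.+1] of the total,
    so a geometric series in [q ^+ m.+1] supplies the new factor of [qpoch]. *)
Lemma abs_sum_partitions (K : numFieldType) (q : K) (I : choiceType) m D cod :
  abs_summable_cvg K -> power_cvg0 K -> `|q| < 1 ->
  encodes_sorted I m D cod ->
  abs_sum K I D (fun i => q ^+ sumn (cod i)) (qpoch q m)^-1 (qpoch `|q| m)^-1.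
Proof.
move=> cvgK cvg0 q1; elim: m D cod => [|m IH] D cod cod_m.
  have [cod_sorted cod_inj cod_surj] := cod_m.
  have [i Di cod_i] := cod_surj [::] erefl isT.
  have := abs_sum1 K I i (fun i => q ^+ sumn (cod i)).
  rewrite /qpoch !big_geq// invr1 cod_i expr0 normr1; apply: eq_abs_sum => // j /=.
  apply/eqP/idP => [->//|Dj]; apply: cod_inj => //; rewrite cod_i.
  by have [/size0nil] := cod_sorted _ Dj.
have qm1 : `|q| ^+ m.+1 < 1 by rewrite exprn_ilt1.
have qm0 : 0 <= `|q| ^+ m.+1 by rewrite exprn_ge0.
have qpoch_ge0 k : 0 <= (qpoch `|q| k)^-1.
  by rewrite invr_ge0 prodr_ge0// => i _; rewrite subr_ge0 exprn_ile1// ltW.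
pose s n := (q ^+ m.+1) ^+ n * (qpoch q m)^-1.
pose M n := (`|q| ^+ m.+1) ^+ n * (qpoch `|q| m)^-1.
have [||S fS sS] := abs_sum_fibers K I cvgK D (fun i => q ^+ sumn (cod i))
    (fun i => head 0%N (cod i)) s M (qpoch `|q| m.+1)^-1.
- move=> n; have := abs_sumZ K I _ ((q ^+ m.+1) ^+ n) _ _ _
    (IH _ _ (encodes_sorted_head _ _ _ _ n cod_m)).
  rewrite !normrX; apply: eq_abs_sum => // i /andP[Di /eqP cod_i].
  have [cod_sorted _ _] := cod_m; have [] := cod_sorted _ Di; move: cod_i.
  rewrite -!exprM -exprD; case: (cod i) => //= _ t -> [<-].
  rewrite (path_sortedE leq_trans) => /andP[nt _].
  by congr (q ^+ _); rewrite (sumn_map_subn _ _ nt); lia.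
- move=> N; rewrite /M -mulr_suml qpochS invfM mulrC ler_wpM2l//.
  by rewrite geometric_sum_le// qm0.
(* Grouping only yields some sum [S]; uniqueness of limits identifies it with the closed form. *)
have sS' : \sum_(0 <= n < N) s n @[N --> \oo] --> (qpoch q m.+1)^-1.
  under eq_cvg do rewrite -mulr_suml mulrC.
  rewrite qpochS invfM; apply: cvgM; first exact: cvg_cst.
  by apply: cvg_geometric_sum => //; rewrite normrX.
by rewrite -(cvg_unique (@norm_hausdorff K K) sS sS').
Qed.

(** * Overpartitions and their staircases *)

Section Overpartitions.

Local Open Scope nat_scope.

Definition sizes (b : bool) (s : seq part) : seq nat :=
  [seq psize p | p <- s & overlined p == b].

(* Total order for which overpartitions are sorted: larger sizes first and,
   among equal sizes, the overlined part first. *)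
Definition part_le (p p' : part) : bool :=
  (psize p' < psize p) || (psize p == psize p') && (overlined p' ==> overlined p).

Lemma part_le_trans : transitive part_le.
Proof.
rewrite /part_le /psize /overlined => -[x b] [y c] [z d] /=.
case: b; case: c; case: d => /=; lia.
Qed.

Lemma part_le_anti : antisymmetric part_le.
Proof.
rewrite /part_le /psize /overlined => -[x b] [y c] /= xy.
by congr (_, _); move: xy; case: b; case: c => /=; lia.
Qed.

Lemma part_le_total : total part_le.
Proof.
rewrite /part_le /psize /overlined => -[x b] [y c] /=.
by case: b; case: c => /=; lia.
Qed.

Definition parts_of (N O : seq nat) : seq part :=
  [seq (t, false) | t <- N] ++ [seq (t, true) | t <- O].

Lemma parts_of_sizes s : perm_eq s (parts_of (sizes false s) (sizes true s)).
Proof.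
rewrite perm_sym /parts_of /sizes -!map_comp !map_id_in.
- by rewrite [X in _ ++ X](@eq_filter _ _ (predC (fun p => overlined p == false)))
    ?perm_filterC// => -[t []].
- by move=> [t b]; rewrite mem_filter => /andP[/eqP <-].
- by move=> [t b]; rewrite mem_filter => /andP[/eqP <-].
Qed.

(** Among equal sizes, the third clause of [is_overpartition] forbids an overlined part after
    another part, which is how [part_le] breaks ties. *)
Lemma overpartition_sorted s : is_overpartition s -> sorted part_le s.
Proof.
move=> /and3P[_]; rewrite sorted_map (sorted_pairwise part_le_trans).
rewrite sorted_pairwise; last by move=> x y z /=; lia.
move=> s1 s2; have := conj s1 s2; move=> /andP; rewrite -pairwise_relI.
apply: sub_pairwise => -[x b] [y c]; rewrite /part_le /psize /overlined /=.
by case: b; case: c => /=; lia.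
Qed.

(** The two lists of sizes determine the multiset of parts, and a sorted list for an antisymmetric
    transitive relation is determined by its multiset. *)
Lemma overpartition_inj s s' : is_overpartition s -> is_overpartition s' ->
  sizes false s = sizes false s' -> sizes true s = sizes true s' -> s = s'.
Proof.
move=> /overpartition_sorted ss /overpartition_sorted ss' eN eO.
apply: (sorted_eq part_le_trans part_le_anti) => //.
by rewrite (perm_trans (parts_of_sizes s))// perm_sym eN eO parts_of_sizes.
Qed.

(** Filtering commutes with sorting, and each of the two classes is already sorted. *)
Lemma sizes_sort_parts b N O : sorted geq N -> sorted gtn O ->
  sizes b (sort part_le (parts_of N O)) = if b then O else N.
Proof.
move=> sN sO; rewrite /sizes (filter_sort part_le_total part_le_trans) filter_cat.
have filt c (t : seq nat) : [seq p <- [seq (x, c) | x <- t] | overlined p == b] =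
    if c == b then [seq (x, c) | x <- t] else [::].
  rewrite filter_map /preim /overlined /=.
  by case: eqP => _; rewrite ?filter_predT ?filter_pred0.
rewrite !filt; case: b {filt} => /=; rewrite ?cats0 (sorted_sort part_le_trans)//.
- by rewrite -map_comp map_id.
- rewrite sorted_map; apply: sub_sorted sO => x y /=.
  by rewrite /part_le /psize /= => ->.
- by rewrite -map_comp map_id.
- rewrite sorted_map; apply: sub_sorted sN => x y /=.
  by rewrite /part_le /psize /overlined /=; lia.
Qed.

Lemma pairwise_filter_uniq (T : eqType) (a : pred T) (s : seq T) :
  uniq [seq x <- s | a x] ->
  pairwise (fun p p' => ~~ [&& a p, a p' & p == p']) s.
Proof.
elim: s => //= x s IH; case: ifP => ax /=; last first.
  by move=> /IH ->; rewrite andbT; apply/allP.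
move=> /andP[xs /IH ->]; rewrite andbT; apply/allP => y ys.
by apply: contra xs => /andP[ay /eqP ->]; rewrite mem_filter ay.
Qed.

Lemma sort_parts_overpartition N O :
  all (leq 1) (N ++ O) -> sorted gtn O ->
  is_overpartition (sort part_le (parts_of N O)).
Proof.
move=> pos sO; set s := sort _ _.
have s_sorted : sorted part_le s by apply: sort_sorted; exact: part_le_total.
apply/and3P; split.
- rewrite all_sort all_cat !all_map; move: pos; rewrite all_cat.
  by congr (_ && _).
- rewrite sorted_map; apply: sub_sorted s_sorted => p p' /=.
  by rewrite /part_le; lia.
(* Before an overlined part of the same size, [part_le] excludes a non-overlined part and this fact
   excludes an overlined one. *)
- have O_once : pairwise (fun p p' => ~~ [&& overlined p, overlined p' & p == p']) s.
    apply: pairwise_filter_uniq.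
    rewrite (perm_uniq (perm_filter _ (permEl (perm_sort _ _)))).
    rewrite filter_cat !filter_map /= (eq_filter (a2 := pred0)) ?filter_pred0//=.
    rewrite (eq_filter (a2 := predT)) ?filter_predT// map_inj_uniq; last by move=> ? ? [].
    by apply: sorted_uniq sO => [x y z|x] /=; lia.
  move: s_sorted; rewrite (sorted_pairwise part_le_trans) => s_pairwise.
  have /andP := conj s_pairwise O_once; rewrite -pairwise_relI.
  apply: sub_pairwise => -[x b] [y c] /=; rewrite /part_le /overlined /psize /=.
  case: b; case: c => //=; last by lia.
  by move=> /andP[_]; apply: contraNneq => ->.
Qed.

(* Sizes of the parts, smallest first, of an element of E_O^N with [k]
   overlined parts. *)
Definition staircase_type (k : nat) (t : seq nat) : Prop :=
  [/\ k < size t, sorted leq t, sorted ltn (take k t) & all (leq 1) t].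

(** The sequence 1, 2, ..., [k], [k], [k], ..., indexed from 0; [maxn 1 k] makes it constantly 1
    when [k = 0]. *)
Definition stair (k i : nat) : nat := minn i.+1 (maxn 1 k).

Definition sub_stairs k t := mkseq (fun i => nth 0 t i - stair k i) (size t).
Definition add_stairs k s := mkseq (fun i => nth 0 s i + stair k i) (size s).

(** Induction on [i]: strict growth of the first [k] entries follows the rise of the stairs, and
    weak growth suffices once they are flat. Thus the subtraction in [sub_stairs] is not
    truncated. *)
Lemma stair_le_nth k t i : staircase_type k t -> i < size t -> stair k i <= nth 0 t i.
Proof.
move=> [kt t_sorted tk_sorted t_pos]; elim: i => [|i IH] it.
  by rewrite /stair; apply: leq_trans (geq_minl _ _) _; exact: all_nthP it.
have ti := sortedP 0 t_sorted i it.
have {}IH := IH (ltnW it).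
case: (ltnP i.+1 k) => ik; last by rewrite /stair in IH *; lia.
have := sortedP 0 tk_sorted i; rewrite size_take kt ik => /(_ isT).
by rewrite !nth_take//; [rewrite /stair in IH *; lia | lia].
Qed.

Lemma sub_stairsK k t : staircase_type k t -> add_stairs k (sub_stairs k t) = t.
Proof.
move=> kt; apply: (@eq_from_nth _ 0) => [|i]; rewrite !size_mkseq// => it.
by rewrite !nth_mkseq ?size_mkseq// subnK// stair_le_nth.
Qed.

Lemma add_stairsK k s : sub_stairs k (add_stairs k s) = s.
Proof.
apply: (@eq_from_nth _ 0) => [|i]; rewrite !size_mkseq// => it.
by rewrite !nth_mkseq ?size_mkseq// addnK.
Qed.

(** The stairs rise, by one, only between indices below [k], where [t] increases strictly. *)
Lemma sub_stairs_sorted k t : staircase_type k t -> sorted leq (sub_stairs k t).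
Proof.
move=> kt; apply/(sortedP 0) => i; rewrite size_mkseq => it.
rewrite !nth_mkseq//; last exact: ltnW.
have ti := stair_le_nth _ _ _ kt it.
have tSi := stair_le_nth _ _ _ kt (ltnW it).
move: kt => [kt t_sorted tk_sorted t_pos].
have := sortedP 0 t_sorted i it.
case: (ltnP i.+1 k) => ik; last by rewrite /stair in ti tSi *; lia.
have := sortedP 0 tk_sorted i; rewrite size_take kt ik => /(_ isT).
by rewrite !nth_take//; [rewrite /stair in ti tSi *; lia | lia].
Qed.

Lemma add_stairs_type k s : k < size s -> sorted leq s ->
  staircase_type k (add_stairs k s).
Proof.
move=> ks s_sorted; split.
- by rewrite size_mkseq.
- apply/(sortedP 0) => i; rewrite size_mkseq => it.
  have := sortedP 0 s_sorted i it.
  by rewrite !nth_mkseq//; [rewrite /stair; lia | exact: ltnW].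
- apply/(sortedP 0) => i; rewrite size_take size_mkseq ks => ik.
  have := sortedP 0 s_sorted i; rewrite (ltn_trans ik)// => /(_ isT).
  by rewrite !nth_take ?nth_mkseq//; rewrite /stair; lia.
- apply/(all_nthP 0) => i; rewrite size_mkseq => it.
  by rewrite nth_mkseq// /stair; lia.
Qed.

(** The case [k = 0] is apart because the stairs are then constantly 1; it gives the isolated
    [q ^+ m] of [rhs_term]. *)
Definition stairs_weight (m k : nat) : nat := if k == 0 then m else k * m - 'C(k, 2).

Lemma sum_stair m k : k < m -> \sum_(0 <= i < m) stair k i = stairs_weight m k.
Proof.
rewrite /stairs_weight; case: eqP => [-> _|/eqP k0 km].
  rewrite -[RHS]muln1 -[in RHS](subn0 m) -sum_nat_const_nat; apply: eq_bigr => i _.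
  by rewrite /stair; lia.
(* The rising steps, in additive form to avoid truncated subtraction; each later step adds [k]. *)
have triangle n : n <= k -> \sum_(0 <= i < n) stair k i + 'C(n, 2) = n * n.
  elim: n => [|n IH] nk; first by rewrite big_geq.
  have := IH (ltnW nk); rewrite big_nat_recr//= binS bin1 mulSn mulnS.
  move: (\sum_(0 <= i < n) stair k i) => ?.
  by have -> : stair k n = n.+1; rewrite /stair; lia.
have := triangle k (leqnn k); have -> : m = k + (m - k) by lia.
elim: (m - k) => [|d IH]; first by rewrite addn0; lia.
move=> Ck; rewrite addnS big_nat_recr ?leq_addr//= (IH Ck) mulnS mulnDr.
by have -> : stair k (k + d) = k; rewrite /stair; lia.
Qed.

Lemma sumn_sub_stairs k t : staircase_type k t ->
  sumn t = stairs_weight (size t) k + sumn (sub_stairs k t).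
Proof.
move=> kt; rewrite -[in LHS](sub_stairsK k t kt) -sum_stair; last by case: kt.
rewrite !sumnE /add_stairs /mkseq !big_map size_mkseq /index_iota subn0 -big_split /=.
apply: eq_big_seq => i; rewrite mem_iota add0n => it.
by rewrite /sub_stairs nth_mkseq// addnC.
Qed.

(** Overlined sizes first: on E_O^N, where they are the smaller ones, this list is nondecreasing. *)
Definition ascending (s : seq part) : seq nat := rev (sizes false s ++ sizes true s).

Lemma size_ascending s : size (ascending s) = size s.
Proof.
rewrite size_rev (perm_size (parts_of_sizes s)) /parts_of !size_cat !size_map.
by rewrite !size_filter.
Qed.

Lemma sumn_ascending s : sumn (ascending s) = sumn (map psize s).
Proof.
rewrite sumn_rev (perm_sumn (perm_map psize (parts_of_sizes s))).
rewrite /parts_of map_cat -!map_comp.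
by congr (sumn (_ ++ _)); rewrite map_id.
Qed.

Lemma take_ascending s : take (size (sizes true s)) (ascending s) = rev (sizes true s).
Proof. by rewrite /ascending rev_cat take_size_cat ?size_rev. Qed.

(** The number of overlined parts tells where to cut the list into its two classes. *)
Lemma ascending_inj s s' : is_overpartition s -> is_overpartition s' ->
  size (sizes true s) = size (sizes true s') -> ascending s = ascending s' -> s = s'.
Proof.
move=> ss ss' eO; rewrite /ascending !rev_cat => /eqP; rewrite eqseq_cat; last first.
  by rewrite !size_rev.
move=> /andP[/eqP/(can_inj revK) eqO /eqP/(can_inj revK) eqN].
exact: overpartition_inj.
Qed.

Lemma in_EON_sizes (o : overpartition) : in_EON o =
  (0 < size (sizes false o)) && allrel geq (sizes false o) (sizes true o).
Proof.
rewrite /in_EON /sizes size_map size_filter -has_count allrel_mapl allrel_mapr.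
congr (_ && _); first by apply: eq_has => p; case: (overlined p).
congr (allrel _ _ _); apply: eq_filter => p; by case: (overlined p).
Qed.

Lemma EON_staircase (o : EON) :
  staircase_type (size (sizes true (val o))) (ascending (val o)).
Proof.
case: o => -[s so] /=; rewrite in_EON_sizes /= => /andP[N0 NO].
have geq_trans : transitive geq by move=> x y z /=; lia.
have /and3P[s_pos s_sorted s_over] := so.
have sizes_sorted b : sorted geq (sizes b s).
  rewrite sorted_map; apply: sorted_filter; last by rewrite -sorted_map.
  by move=> x y z /=; lia.
split.
- by rewrite /ascending size_rev size_cat; lia.
- rewrite /ascending rev_sorted sorted_pairwise// pairwise_cat NO /=.
  by rewrite -!sorted_pairwise// !sizes_sorted.
(* Overlined sizes decrease weakly, and the third clause of [is_overpartition] makes them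
   distinct. *)
- rewrite take_ascending rev_sorted; apply: pairwise_sorted.
  have := sizes_sorted true; rewrite sorted_pairwise// /sizes !pairwise_map => s_geq.
  have /andP := conj s_geq (pairwise_filter (fun p => overlined p == true) s_over).
  rewrite -pairwise_relI.
  apply: (sub_in_pairwise (P := fun p => overlined p)); last first.
    by apply/allP => p; rewrite mem_filter => /andP[/eqP].
  by move=> p p' _ /= op'; rewrite unfold_in in op'; rewrite op' /=; lia.
- rewrite all_rev all_cat !all_map !all_filter.
  by apply/andP; split; apply: sub_all s_pos => p /= ->; rewrite implybT.
Qed.

Definition EON_code (o : EON) : seq nat :=
  sub_stairs (size (sizes true (val o))) (ascending (val o)).

Lemma weight_EON_code (o : EON) : weight (val o) =
  stairs_weight (size (parts (val o))) (size (sizes true (val o))) + sumn (EON_code o).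
Proof.
by rewrite /weight -sumn_ascending (sumn_sub_stairs _ _ (EON_staircase o)) size_ascending.
Qed.

(** The first [k] entries become the overlined parts; [k < size t] leaves at least one non-overlined
    part. *)
Lemma staircase_EON k t : staircase_type k t ->
  exists2 o : EON, ascending (val o) = t & size (sizes true (val o)) = k.
Proof.
move=> [kt t_sorted tk_sorted t_pos].
pose O := rev (take k t); pose N := rev (drop k t).
have NO : N ++ O = rev t by rewrite -rev_cat cat_take_drop.
have sO : sorted gtn O by rewrite rev_sorted.
have geq_trans : transitive geq by move=> x y z /=; lia.
have /and3P[NO_geq sN _] : [&& allrel geq N O, pairwise geq N & pairwise geq O].
  by rewrite -pairwise_cat NO -sorted_pairwise// rev_sorted.
have {}sN : sorted geq N by rewrite sorted_pairwise.
pose s := sort part_le (parts_of N O).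
have s_over : is_overpartition s.
  by apply: sort_parts_overpartition => //; rewrite NO all_rev.
have eO : sizes true s = O := sizes_sort_parts true N O sN sO.
have eN : sizes false s = N := sizes_sort_parts false N O sN sO.
have s_EON : in_EON (Overpartition s_over).
  by rewrite in_EON_sizes /= eO eN NO_geq size_rev size_drop; lia.
exists (exist (fun o : overpartition => in_EON o) _ s_EON); rewrite /= ?eO.
  by rewrite /ascending eO eN NO revK.
by rewrite size_rev size_take kt.
Qed.

Lemma EON_encodes_sorted m k : k < m ->
  encodes_sorted EON m
    (fun o => (size (parts (val o)) == m) && (size (sizes true (val o)) == k)) EON_code.
Proof.
move=> km; split=> [p /andP[/eqP pm _]|p p'|s sm s_sorted].
- by rewrite size_mkseq size_ascending pm (sub_stairs_sorted _ _ (EON_staircase p)).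
- rewrite !unfold_in => /andP[_ /eqP pk] /andP[_ /eqP pk'] /(congr1 (add_stairs k)).
  have := EON_staircase p; have := EON_staircase p'; rewrite /EON_code pk pk' => kt kt'.
  rewrite !sub_stairsK// => pp'; apply/val_inj/val_inj.
  apply: ascending_inj => //; first exact: (valP (val p)).
    exact: (valP (val p')).
  by rewrite pk pk'.
- rewrite -sm in km.
  have [p pt pk] := staircase_EON _ _ (add_stairs_type _ _ km s_sorted).
  exists p; last by rewrite /EON_code pk pt add_stairsK.
  by rewrite pk -size_ascending pt size_mkseq sm !eqxx.
Qed.

End Overpartitions.

(** * Summation over E_O^N *)

(** A crude bound that dominates the double sum by geometric series: [m] serves the sum over [m],
    and [k.-1] the sum over [k]. *)
Lemma stairs_weight_ge m k : (k < m)%N -> (m + k.-1 <= stairs_weight m k)%N.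
Proof.
rewrite /stairs_weight; case: k => [|k] km /=; first by rewrite addn0.
have : ('C(k.+1, 2) <= k * k)%N.
  by elim: k {km} => // k IH; rewrite binS bin1 mulSn mulnS; lia.
by move: ('C(_, _)) => c; nia.
Qed.

(** A bound uniform in [m]: for [x = r ^+ i] with [i >= 1], the factor
    [(1 - x)^-1 = 1 + x / (1 - x)] is at most [expR (x / (1 - r))], and the exponents add up to a
    geometric sum. *)
Lemma qpoch_inv_le (R : realType) (r : R) m : 0 <= r < 1 ->
  (qpoch r m)^-1 <= expR ((1 - r)^-1 / (1 - r)).
Proof.
move=> /andP[r0 r1]; have r1' : 0 < 1 - r by rewrite subr_gt0.
suff : (qpoch r m)^-1 <= expR ((\sum_(0 <= i < m.+1) r ^+ i) / (1 - r)).
  move=> /le_trans; apply; rewrite ler_expR ler_pM2r ?invr_gt0//.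
  by rewrite geometric_sum_le// r0.
elim: m => [|m IH].
  rewrite /qpoch big_geq// invr1 big_nat1 expr0.
  by rewrite -[leLHS]expR0 ler_expR divr_ge0// ltW.
rewrite qpochS big_nat_recr//= mulrDl expRD invfM.
have x0 : 0 <= r ^+ m.+1 by rewrite exprn_ge0.
have xr : r ^+ m.+1 <= r by rewrite exprS ler_piMr// exprn_ile1// ltW.
have x1 : 0 < 1 - r ^+ m.+1 by rewrite subr_gt0 (le_lt_trans xr).
apply: ler_pM => //; rewrite ?invr_ge0 ?(ltW x1)//.
  by rewrite prodr_ge0// => i _; rewrite subr_ge0 exprn_ile1// ltW.
apply: le_trans (expR_ge1Dx _).
have -> : (1 - r ^+ m.+1)^-1 = 1 + r ^+ m.+1 / (1 - r ^+ m.+1).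
  by apply/eqP; rewrite eq_sym -subr_eq0; apply/eqP; field; rewrite gt_eqF.
by rewrite lerD2l ler_wpM2l// lef_pV2 ?posrE// lerB.
Qed.

Lemma stairs_sum_le (R : realType) (r : R) : 0 <= r < 1 ->
  exists B, forall N,
    \sum_(0 <= m < N) \sum_(0 <= k < m) r ^+ stairs_weight m k / qpoch r m <= B.
Proof.
move=> r01; have /andP[r0 r1] := r01; have r1' : 0 < 1 - r by rewrite subr_gt0.
pose c := expR ((1 - r)^-1 / (1 - r)).
(* Bounds the sum of the [r ^+ k.-1]: the term at [k = 0] is 1, and those from [k = 1] on form a
   geometric series. *)
pose d := 1 + (1 - r)^-1.
have d0 : 0 <= d by rewrite addr_ge0// invr_ge0 ltW.
exists ((1 - r)^-1 * (d * c)) => N.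
have term_le m : \sum_(0 <= k < m) r ^+ stairs_weight m k / qpoch r m <=
    r ^+ m * (d * c).
  rewrite -mulr_suml mulrA ler_pM ?qpoch_inv_le//.
  - by rewrite sumr_ge0// => k _; rewrite exprn_ge0.
  - rewrite invr_ge0 prodr_ge0// => i _; rewrite subr_ge0 exprn_ile1//.
    exact: ltW.
  apply: (@le_trans _ _ (\sum_(0 <= k < m) r ^+ m * r ^+ k.-1)).
    apply: ler_sum_nat => k /= km; rewrite -exprD ler_wiXn2l//; first exact: ltW.
    exact: stairs_weight_ge.
  rewrite -mulr_sumr ler_wpM2l ?exprn_ge0//.
  case: m => [|m]; first by rewrite big_geq.
  by rewrite big_ltn// expr0 big_add1 /= lerD2l geometric_sum_le.
apply: (@le_trans _ _ (\sum_(0 <= m < N) r ^+ m * (d * c))).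
  by apply: ler_sum => m _; exact: term_le.
rewrite -mulr_suml ler_wpM2r ?geometric_sum_le// mulr_ge0//.
exact: expR_ge0.
Qed.

Lemma rmorph_qpoch (K L : comNzRingType) (f : {rmorphism K -> L}) (q : K) m :
  f (qpoch q m) = qpoch (f q) m.
Proof.
by rewrite rmorph_prod; apply: eq_bigr => i _; rewrite rmorphB rmorph1 rmorphXn.
Qed.

(** The estimate uses the real exponential, while [|q|] lies in [R[i]]; the embedding of [R] carries
    it over. *)
Lemma stairs_sum_norm_le (R : realType) (q : R[i]) : `|q| < 1 ->
  exists B : R[i], forall N,
    \sum_(0 <= m < N) \sum_(0 <= k < m) `|q| ^+ stairs_weight m k / qpoch `|q| m <= B.
Proof.
move=> q1; have [r r_q] : exists r : R, `|q| = r%:C%C.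
  by exists (complex.Re `|q|); rewrite RRe_real ?normr_real.
have r0 : 0 <= r by rewrite -ler0c -r_q.
have r1 : r < 1 by rewrite -ltcR -r_q.
have [|B rB] := stairs_sum_le R r; first by rewrite r0.
exists B%:C%C => N; have := rB N; rewrite -lecR; apply: le_trans.
rewrite le_eqVlt; apply/orP; left; apply/eqP; rewrite r_q rmorph_sum.
apply: eq_bigr => m _; rewrite rmorph_sum; apply: eq_bigr => k _.
by rewrite fmorph_div rmorphXn rmorph_qpoch.
Qed.

Lemma rhs_term_stairs (K : fieldType) (q : K) m : (0 < m)%N ->
  \sum_(0 <= k < m) q ^+ stairs_weight m k / qpoch q m = rhs_term q m.
Proof.
move=> m0; rewrite -mulr_suml mulrC /rhs_term big_ltn//; congr (_ * (_ + _)).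
by apply: eq_big_nat => k /andP[k0 _]; rewrite /stairs_weight gtn_eqF.
Qed.

Lemma EON_abs_sum (K : numFieldType) (q B : K) :
  abs_summable_cvg K -> power_cvg0 K -> `|q| < 1 ->
  (forall N, \sum_(0 <= m < N) \sum_(0 <= k < m)
     `|q| ^+ stairs_weight m k / qpoch `|q| m <= B) ->
  exists2 S : K, psum xpredT (fun o : EON => q ^+ weight (val o)) @ totally --> S
    & \sum_(1 <= m < n) rhs_term q m @[n --> \oo] --> S.
Proof.
move=> cvgK cvg0 q1 qB.
pose nparts (p : EON) := size (parts (val p)).
pose nover (p : EON) := size (sizes true (val p)).
pose f (p : EON) := q ^+ weight (val p).
have [m|S [fS _] sS] := abs_sum_fibers K EON cvgK xpredT f nparts
    (fun m => \sum_(0 <= k < m) q ^+ stairs_weight m k / qpoch q m) _ B _ qB.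
  have := abs_sum_partition K EON (fun p => nparts p == m) f nover
    (fun k => q ^+ stairs_weight m k / qpoch q m)
    (fun k => `|q| ^+ stairs_weight m k / qpoch `|q| m) m.
  (* Some part is not overlined, so finitely many values of [nover] exhaust the fibre and a finite
     partition suffices. *)
  have lt_over p : nparts p == m -> (nover p < m)%N.
    by move=> /eqP <-; have [+ _ _ _] := EON_staircase p; rewrite size_ascending.
  move=> fm; apply: eq_abs_sum (fm _) => // [p|k km].
    by case: eqP => //= /eqP/lt_over.
  have := abs_sumZ K EON _ (q ^+ stairs_weight m k) _ _ _
    (abs_sum_partitions K q EON m _ _ cvgK cvg0 q1 (EON_encodes_sorted m k km)).
  rewrite normrX; apply: eq_abs_sum => // p /andP[/eqP pm /eqP pk].
  by rewrite /f weight_EON_code pm pk exprD.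
exists S => //.
(* At [m = 0] the inner sum is empty, whereas [rhs_term q 0] is 1; hence the start at 1. *)
have rhsE n : \sum_(1 <= m < n) rhs_term q m =
    \sum_(0 <= m < n) \sum_(0 <= k < m) q ^+ stairs_weight m k / qpoch q m.
  case: n => [|n]; first by rewrite !big_geq.
  rewrite [RHS]big_ltn// [X in X + _]big_geq// add0r.
  by apply: eq_big_nat => m /andP[m0 _]; rewrite rhs_term_stairs.
by under eq_cvg do rewrite rhsE.
Qed.

Theorem mainTheorem8 (R : realType) (q : R[i]^o) (hq : `|q| < 1) :
  [/\ cvg (partial_sum (fun o : EON => q ^+ weight (val o)) @ totally),
      cvg ((\sum_(1 <= m < n) rhs_term q m) @[n --> \oo])
    & summability.sum (fun o : EON => q ^+ weight (val o)) =
      limn (fun n => \sum_(1 <= m < n) rhs_term q m)].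
Proof.
have [B qB] := stairs_sum_norm_le R q hq.
have [S fS sS] := EON_abs_sum R[i] q B (complex_abs_summable_cvg R)
  (complex_power_cvg0 R) hq qB.
have {}fS : partial_sum (fun o : EON => q ^+ weight (val o)) @ totally --> (S : R[i]^o).
  rewrite [partial_sum _](_ : _ = psum xpredT (fun o : EON => q ^+ weight (val o)))//.
  by apply/funext => A; rewrite /partial_sum /psum big_seq_fsetE.
have {}sS : (\sum_(1 <= m < n) rhs_term q m) @[n --> \oo] --> (S : R[i]^o) by [].
split; [by apply/cvg_ex; exists S|by apply/cvg_ex; exists S|].
by rewrite /summability.sum (cvg_lim _ fS)// (cvg_lim _ sS).
Qed.
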